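(* Let $m\le n$, let $0\le r\le m$ be the truncation number, let $\dot{\mathbf M}\in\mathbb H^{m\times n}$ be the observed quaternion matrix with observed index set $\Omega$, and let $\mathbf W_1,\mathbf W_2\in\mathbb R^{m\times m}$ be the real diagonal weight matrices described in the context. Let $\varepsilon_1>0$, $\rho>1$ and $\varepsilon_{k+1}=\rho\,\varepsilon_k$ for $k=1,2,\dots$, so that $0<\varepsilon_k<\varepsilon_{k+1}$ and $\lim_{k\to\infty}\frac1{\varepsilon_k}=0$. Let $(\dot{\mathbf X}_k)_{k\ge1}$ be the sequence produced by the DWQTNN method: $\dot{\mathbf X}_1=P_\Omega(\dot{\mathbf M})$ and, for $k\ge1$, $$\widetilde{\mathbf X}_{k+1}=\dot{\mathbf X}_k-\frac1{\varepsilon_k}\left(\mathbf W_1\dot{\mathbf A}_k^H\dot{\mathbf B}_k-\mathbf W_2\dot{\mathbf C}_k^H\dot{\mathbf D}_k\right),\qquad \dot{\mathbf X}_{k+1}=P_{\Omega^C}(\widetilde{\mathbf X}_{k+1})+P_\Omega(\dot{\mathbf M}),$$ where $\dot{\mathbf A}_k,\dot{\mathbf B}_k,\dot{\mathbf C}_k,\dot{\mathbf D}_k$ are obtained from a QSVD of $\dot{\mathbf X}_k$ as in the context. Then the sequence $(\dot{\mathbf X}_k)$ converges, and for every tolerance $\epsilon>0$, $$\|\dot{\mathbf X}_{N+1}-\dot{\mathbf X}_N\|_F\le\epsilon\qquad\text{for every integer } N\ge1 \text{ with } N\ge 1-\frac{\ln(\varepsilon_1\epsilon)-\ln(c)}{\ln(\rho)},$$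 where $c=\|\mathbf W_1\|_F\,m^{\frac12}+\|\mathbf W_2\|_F\,r^{\frac12}$.
   Context: $\mathbb H$ denotes the real quaternions; $(\cdot)^H$ is the conjugate transpose; $\|\dot{\mathbf A}\|_F=\sqrt{\sum_{i,j}|\dot a_{ij}|^2}$ is the Frobenius norm, with respect to which convergence is understood. For an index set $\Omega\subseteq\{1,\dots,m\}\times\{1,\dots,n\}$, $P_\Omega$ is the linear operator that keeps the entries of a matrix at positions in $\Omega$ and sets all other entries to $0$; $\Omega^C$ is the complement of $\Omega$. QSVD: every $\dot{\mathbf X}\in\mathbb H^{m\times n}$ can be written $\dot{\mathbf X}=\dot{\mathbf U}\mathbf\Sigma\dot{\mathbf V}^H$ with $\dot{\mathbf U}\in\mathbb H^{m\times m}$, $\dot{\mathbf V}\in\mathbb H^{n\times n}$ unitary and $\mathbf\Sigma\in\mathbb R^{m\times n}$ diagonal with nonnegative singular values in decreasing order. At each iteration $k$ take a QSVD $\dot{\mathbf X}_k=\dot{\mathbf U}_k\mathbf\Sigma_k\dot{\mathbf V}_k^H$; with $\dot{\mathbf u}_i$, $\dot{\mathbf v}_i$ the columns of $\dot{\mathbf U}_k$, $\dot{\mathbf V}_k$, set $\dot{\mathbf A}_k=\dot{\mathbf U}_k^H$, $\dot{\mathbf B}_k=(\dot{\mathbf v}_1,\dots,\dot{\mathbf v}_m)^H$, $\dot{\mathbf C}_k=(\dot{\mathbf u}_1,\dots,\dot{\mathbf u}_r)^H$, $\dot{\mathbf D}_k=(\dot{\mathbf v}_1,\dots,\dot{\mathbf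 v}_r)^H$. The weight matrices are $\mathbf W_1=\operatorname{diag}(\tilde w_1,\dots,\tilde w_m)$ and $\mathbf W_2=\operatorname{diag}(\hat w_1,\dots,\hat w_m)$ with real entries such that, if $n_i$ denotes the number of observed entries in row $i$, then $n_i\le n_j$ implies $\tilde w_i\ge\tilde w_j\ge1$ and $\hat w_i\ge\hat w_j\ge1$. *)

(* Defs.v *)
From HB Require Import structures.
From mathcomp Require Import all_boot all_order all_algebra ring.
From mathcomp Require Import reals.

Set Implicit Arguments.
Unset Strict Implicit.
Unset Printing Implicit Defensive.

Import Order.TTheory GRing.Theory Num.Theory.
Local Open Scope ring_scope.

(* Quat a b c d stands for a + b i + c j + d k. *)
Record quat (R : realType) : Type :=
  Quat { qre : R; qi : R; qj : R; qk : R }.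

Section QuaternionRing.
Variable R : realType.
Implicit Types x y z : quat R.

Definition tuple_of_quat x : R * R * R * R := (qre x, qi x, qj x, qk x).
Definition quat_of_tuple (t : R * R * R * R) : quat R :=
  Quat t.1.1.1 t.1.1.2 t.1.2 t.2.

Lemma tuple_of_quatK : cancel tuple_of_quat quat_of_tuple.
Proof. by case. Qed.

HB.instance Definition _ := Choice.copy (quat R) (can_type tuple_of_quatK).

Definition zeroq : quat R := Quat 0 0 0 0.
Definition oneq : quat R := Quat 1 0 0 0.
Definition oppq x : quat R := Quat (- qre x) (- qi x) (- qj x) (- qk x).
Definition addq x y : quat R :=
  Quat (qre x + qre y) (qi x + qi y) (qj x + qj y) (qk x + qk y).

(* Hamilton product: i^2 = j^2 = k^2 = -1, ij = k, jk = i, ki = j. *)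
Definition mulq x y : quat R :=
  Quat (qre x * qre y - qi x * qi y - qj x * qj y - qk x * qk y)
       (qre x * qi y + qi x * qre y + qj x * qk y - qk x * qj y)
       (qre x * qj y - qi x * qk y + qj x * qre y + qk x * qi y)
       (qre x * qk y + qi x * qj y - qj x * qi y + qk x * qre y).

Lemma addqA : associative addq.
Proof. by move=> [????] [????] [????]; congr Quat; rewrite /= addrA. Qed.

Lemma addqC : commutative addq.
Proof. by move=> [????] [????]; congr Quat; rewrite /= addrC. Qed.

Lemma add0q : left_id zeroq addq.
Proof. by move=> [????]; congr Quat; rewrite /= add0r. Qed.

Lemma addNq : left_inverse zeroq oppq addq.
Proof. by move=> [????]; congr Quat; rewrite /= addNr. Qed.

HB.instance Definition _ :=
  GRing.isZmodule.Build (quat R) addqA addqC add0q addNq.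

Lemma mulqA : associative mulq.
Proof. by move=> [????] [????] [????]; congr Quat => /=; ring. Qed.

Lemma mul1q : left_id oneq mulq.
Proof. by move=> [????]; congr Quat => /=; ring. Qed.

Lemma mulq1 : right_id oneq mulq.
Proof. by move=> [????]; congr Quat => /=; ring. Qed.

Lemma mulqDl : left_distributive mulq +%R.
Proof. by move=> [????] [????] [????]; congr Quat => /=; ring. Qed.

Lemma mulqDr : right_distributive mulq +%R.
Proof. by move=> [????] [????] [????]; congr Quat => /=; ring. Qed.

Lemma oneq_neq0 : oneq != 0.
Proof. by apply/eqP => -[/eqP]; rewrite oner_eq0. Qed.

HB.instance Definition _ := GRing.Zmodule_isNzRing.Build (quat R)
  mulqA mul1q mulq1 mulqDl mulqDr oneq_neq0.

Definition realq (a : R) : quat R := Quat a 0 0 0.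
Definition conjq x : quat R := Quat (qre x) (- qi x) (- qj x) (- qk x).
Definition normq x : R :=
  Num.sqrt (qre x ^+ 2 + qi x ^+ 2 + qj x ^+ 2 + qk x ^+ 2).

End QuaternionRing.

Section QuaternionMatrices.
Variable R : realType.

Definition realqmx m n (A : 'M[R]_(m, n)) : 'M[quat R]_(m, n) :=
  map_mx (@realq R) A.

Definition ctransq m n (A : 'M[quat R]_(m, n)) : 'M[quat R]_(n, m) :=
  map_mx (@conjq R) A^T.

Definition normFq m n (A : 'M[quat R]_(m, n)) : R :=
  Num.sqrt (\sum_(i < m) \sum_(j < n) normq (A i j) ^+ 2).

Definition unitaryq n (U : 'M[quat R]_n) : Prop :=
  ctransq U *m U = 1%:M /\ U *m ctransq U = 1%:M.

(* The singular values are the entries S i j with i = j as naturals, S being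
   rectangular. *)
Definition is_qsvd m n (X : 'M[quat R]_(m, n))
    (U : 'M[quat R]_m) (S : 'M[R]_(m, n)) (V : 'M[quat R]_n) : Prop :=
  [/\ unitaryq U,
      unitaryq V,
      [/\ is_diag_mx S,
          forall (i : 'I_m) (j : 'I_n), i = j :> nat -> 0 <= S i j
        & forall (i i' : 'I_m) (j j' : 'I_n), i = j :> nat -> i' = j' :> nat ->
            (i <= i')%N -> S i' j' <= S i j]
    & X = U *m realqmx S *m ctransq V].

Definition first_cols l p q (hpq : (p <= q)%N) (A : 'M[quat R]_(l, q)) :
    'M[quat R]_(l, p) :=
  colsub (widen_ord hpq) A.

Definition proj_on m n (Omega : {set 'I_m * 'I_n}) (X : 'M[quat R]_(m, n)) :
    'M[quat R]_(m, n) :=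
  \matrix_(i, j) if (i, j) \in Omega then X i j else 0.

Definition row_count m n (Omega : {set 'I_m * 'I_n}) (i : 'I_m) : nat :=
  #|[set j : 'I_n | (i, j) \in Omega]|.

Definition admissible_weights m n (Omega : {set 'I_m * 'I_n})
    (w : 'rV[R]_m) : Prop :=
  forall i j : 'I_m, (row_count Omega i <= row_count Omega j)%N ->
    1 <= w 0 j <= w 0 i.

Definition weight_mx m (w : 'rV[R]_m) : 'M[quat R]_m := realqmx (diag_mx w).

End QuaternionMatrices.

(* Main.v *)
(** The entries in Omega never change, so the step X_{k+1} - X_k is, up to the
    factor 1/eps_k, a truncation of W1 U Vm^H - W2 Ur Vr^H, where Vm, Ur, Vr
    consist of the first m, r, r columns of V, U, V.  A product P Q^H of matrices
    with p orthonormal columns has Frobenius norm sqrt p, because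
    ||P Q^H||^2 = Re tr (Q P^H P Q^H) = Re tr (Q Q^H) = Re tr (Q^H Q) = p; only
    the real part of the trace is cyclic over the quaternions.  Hence the step
    is at most c / eps_k = c / (eps_1 rho^(k-1)).  This geometric bound makes
    each real coordinate converge, and taking logarithms in
    c / (eps_1 rho^(N-1)) <= tol gives the stopping index. *)

Require Import Defs.
From mathcomp Require Import all_boot all_order all_algebra ring lra.
From mathcomp Require Import all_classical all_reals all_analysis.

Set Implicit Arguments.
Unset Strict Implicit.
Unset Printing Implicit Defensive.

Import Order.TTheory GRing.Theory Num.Theory.
Import numFieldNormedType.Exports.
Local Open Scope classical_set_scope.
Local Open Scope ring_scope.

(* [normq] alone would denote the absolute value on [rat]. *)
Local Notation normq := Defs.normq.

(** * Quaternion conjugation and modulus *)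

Section QuaternionNorm.
Variable R : realType.
Implicit Types x y : quat R.

Lemma normq_sqr x :
  normq x ^+ 2 = qre x ^+ 2 + qi x ^+ 2 + qj x ^+ 2 + qk x ^+ 2.
Proof. by rewrite sqr_sqrtr// !addr_ge0// sqr_ge0. Qed.

Lemma normq0 : normq (0 : quat R) = 0.
Proof. by rewrite /normq /= !expr0n /= !addr0 sqrtr0. Qed.

Lemma conjq_sum (I : Type) (s : seq I) (F : I -> quat R) :
  conjq (\sum_(i <- s) F i) = \sum_(i <- s) conjq (F i).
Proof.
apply: (big_morph (@conjq R)) => [[????] [????]|]; congr Quat => /=; ring.
Qed.

Lemma qre_sum (I : Type) (s : seq I) (F : I -> quat R) :
  qre (\sum_(i <- s) F i) = \sum_(i <- s) qre (F i).
Proof. exact: (big_morph (@qre R)). Qed.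

Lemma conjqM x y : conjq (x * y) = conjq y * conjq x.
Proof. by case: x y => [????] [????]; congr Quat => /=; ring. Qed.

Lemma conjqK : involutive (@conjq R).
Proof. by case=> *; congr Quat => /=; ring. Qed.

Lemma qre_conjqM x : qre (conjq x * x) = normq x ^+ 2.
Proof. by rewrite normq_sqr; case: x => * /=; ring. Qed.

Lemma qre_mulq_conj x : qre (x * conjq x) = normq x ^+ 2.
Proof. by rewrite normq_sqr; case: x => * /=; ring. Qed.

Lemma normq_realqM (a : R) x : normq (realq a * x) ^+ 2 = a ^+ 2 * normq x ^+ 2.
Proof. by rewrite !normq_sqr; case: x => * /=; ring. Qed.

(** The gap between the two sides is the square [t * (a + t^-1 * b) ^+ 2]. Being linear in the
    squares, the bound can be summed over coordinates and entries for one common [t]; choosing [t]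
    afterwards yields the triangle inequality without Cauchy-Schwarz. *)
Lemma sqr_subr_le (t a b : R) : 0 < t ->
  (a - b) ^+ 2 <= (1 + t) * a ^+ 2 + (1 + t^-1) * b ^+ 2.
Proof.
move=> t0; rewrite -subr_ge0.
suff -> : (1 + t) * a ^+ 2 + (1 + t^-1) * b ^+ 2 - (a - b) ^+ 2 =
  t * (a + t^-1 * b) ^+ 2 by rewrite mulr_ge0 ?sqr_ge0// ltW.
by field; rewrite gt_eqF.
Qed.

Lemma normqB_sqr_le (t : R) x y : 0 < t ->
  normq (x - y) ^+ 2 <= (1 + t) * normq x ^+ 2 + (1 + t^-1) * normq y ^+ 2.
Proof.
move=> t0; rewrite !normq_sqr; case: x y => [a b c d] [a' b' c' d'] /=.
have := sqr_subr_le a a' t0; have := sqr_subr_le b b' t0.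
have := sqr_subr_le c c' t0; have := sqr_subr_le d d' t0.
rewrite !mulrDr; lra.
Qed.

End QuaternionNorm.

(** * Frobenius norm: triangle inequality, orthonormal factors, diagonal weights *)

Section FrobeniusNorm.
Variable R : realType.

Lemma normFq_sqr m n (A : 'M[quat R]_(m, n)) :
  normFq A ^+ 2 = \sum_(i < m) \sum_(j < n) normq (A i j) ^+ 2.
Proof.
by rewrite sqr_sqrtr// sumr_ge0// => i _; rewrite sumr_ge0// => j _; rewrite sqr_ge0.
Qed.

Lemma normFq_ge0 m n (A : 'M[quat R]_(m, n)) : 0 <= normFq A.
Proof. exact: sqrtr_ge0. Qed.

Lemma normFq_le_scale m n p q (A : 'M[quat R]_(m, n)) (B : 'M[quat R]_(p, q)) (a : R) :
  0 <= a -> normFq A ^+ 2 <= a ^+ 2 * normFq B ^+ 2 -> normFq A <= a * normFq B.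
Proof.
by move=> a0; rewrite -exprMn ler_pXn2r// nnegrE ?mulr_ge0 ?normFq_ge0.
Qed.

Lemma ler_normFq m n (A B : 'M[quat R]_(m, n)) (a : R) : 0 <= a ->
  (forall i j, normq (A i j) ^+ 2 <= a ^+ 2 * normq (B i j) ^+ 2) ->
  normFq A <= a * normFq B.
Proof.
move=> a0 AB; apply: normFq_le_scale => //.
rewrite !normFq_sqr mulr_sumr ler_sum// => i _; rewrite mulr_sumr ler_sum//.
Qed.

Lemma normq_le_normFq m n (A : 'M[quat R]_(m, n)) i j : normq (A i j) <= normFq A.
Proof.
rewrite -(@ler_pXn2r _ 2) ?nnegrE ?sqrtr_ge0//.
rewrite normFq_sqr (bigD1 i)//= (bigD1 j)//= -addrA lerDl addr_ge0//.
  by rewrite sumr_ge0// => k _; rewrite sqr_ge0.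
by apply: sumr_ge0 => k _; apply: sumr_ge0 => l _; rewrite sqr_ge0.
Qed.

Lemma normFqB_le m n (A B : 'M[quat R]_(m, n)) : normFq (A - B) <= normFq A + normFq B.
Proof.
apply/ler_addgt0Pr => e e0.
(* Weighted AM-GM with weight b / a, where a and b are perturbed to be positive. *)
pose a := normFq A + e / 2; pose b := normFq B + e / 2.
have a0 : 0 < a by rewrite /a ltr_wpDl ?normFq_ge0 ?divr_gt0.
have b0 : 0 < b by rewrite /b ltr_wpDl ?normFq_ge0 ?divr_gt0.
have -> : normFq A + normFq B + e = a + b by rewrite /a /b; field.
rewrite -(@ler_pXn2r _ 2) ?nnegrE ?normFq_ge0//; last by rewrite addr_ge0// ltW.
have t0 : 0 < b / a by rewrite divr_gt0.
have Aa : normFq A ^+ 2 <= a ^+ 2.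
  by rewrite ler_pXn2r ?nnegrE ?normFq_ge0 ?(ltW a0)// /a lerDl ltW// divr_gt0.
have Bb : normFq B ^+ 2 <= b ^+ 2.
  by rewrite ler_pXn2r ?nnegrE ?normFq_ge0 ?(ltW b0)// /b lerDl ltW// divr_gt0.
apply: (@le_trans _ _ ((1 + b / a) * normFq A ^+ 2 + (1 + (b / a)^-1) * normFq B ^+ 2)).
  rewrite !normFq_sqr !mulr_sumr -big_split ler_sum//= => i _.
  rewrite !mulr_sumr -big_split ler_sum//= => j _.
  by rewrite !mxE; exact: normqB_sqr_le.
(* At weight [b / a] the weighted bound is an equality, the cross term [2ab] splitting evenly. *)
have -> : (a + b) ^+ 2 = (1 + b / a) * a ^+ 2 + (1 + (b / a)^-1) * b ^+ 2.
  by field; rewrite !gt_eqF.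
by rewrite lerD// ler_wpM2l// addr_ge0// ltW// invr_gt0.
Qed.

Lemma ctransqM m n p (A : 'M[quat R]_(m, n)) (B : 'M[quat R]_(n, p)) :
  ctransq (A *m B) = ctransq B *m ctransq A.
Proof.
apply/matrixP => i j; rewrite !mxE conjq_sum; apply: eq_bigr => k _.
by rewrite !mxE conjqM.
Qed.

Lemma ctransqK m n (A : 'M[quat R]_(m, n)) : ctransq (ctransq A) = A.
Proof. by apply/matrixP => i j; rewrite !mxE conjqK. Qed.

Lemma qre_mxtrace_ctransqM m n (A : 'M[quat R]_(m, n)) :
  qre (\tr (ctransq A *m A)) = normFq A ^+ 2.
Proof.
rewrite normFq_sqr exchange_big /mxtrace qre_sum; apply: eq_bigr => j _.
by rewrite mxE qre_sum; apply: eq_bigr => i _; rewrite !mxE qre_conjqM.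
Qed.

(** Paired with [qre_mxtrace_ctransqM], this gives the one instance of cyclicity of the real trace
    that is used: both products have the same real trace because both are the squared norm. *)
Lemma qre_mxtrace_mulmx_ctransq m n (A : 'M[quat R]_(m, n)) :
  qre (\tr (A *m ctransq A)) = normFq A ^+ 2.
Proof.
rewrite normFq_sqr /mxtrace qre_sum; apply: eq_bigr => i _.
by rewrite mxE qre_sum; apply: eq_bigr => j _; rewrite !mxE qre_mulq_conj.
Qed.

Lemma normFq_orthonormal_mul m n p (P : 'M[quat R]_(m, p)) (Q : 'M[quat R]_(n, p)) :
  ctransq P *m P = 1%:M -> ctransq Q *m Q = 1%:M ->
  normFq (P *m ctransq Q) = Num.sqrt p%:R.
Proof.
move=> PP QQ; have : normFq (P *m ctransq Q) ^+ 2 = p%:R.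
  rewrite -qre_mxtrace_ctransqM ctransqM ctransqK.
  rewrite mulmxA -(mulmxA Q) PP mulmx1 qre_mxtrace_mulmx_ctransq.
  rewrite -qre_mxtrace_ctransqM QQ mxtrace1.
  (* The trace of the identity is [p%:R] as a quaternion; induction identifies its real part with
     the real number [p%:R]. *)
  by elim: {P Q PP QQ} p => [|p IH]; rewrite ?mulr0n// !mulrS /= -IH.
by move=> <-; rewrite sqrtr_sqr ger0_norm// normFq_ge0.
Qed.

Lemma first_cols_orthonormal l p q (hpq : (p <= q)%N) (A : 'M[quat R]_(l, q)) :
  ctransq A *m A = 1%:M ->
  ctransq (first_cols hpq A) *m first_cols hpq A = 1%:M.
Proof.
move=> AA; apply/matrixP => i j.
have /matrixP/(_ (widen_ord hpq i) (widen_ord hpq j)) := AA.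
rewrite !mxE => AAij.
transitivity (\sum_k ctransq A (widen_ord hpq i) k * A k (widen_ord hpq j)).
  by apply: eq_bigr => k _; rewrite !mxE.
by rewrite AAij.
Qed.

(** Left multiplication by a diagonal matrix scales row [i] by its weight, and each weight is
    bounded in absolute value by the Frobenius norm of the whole diagonal matrix, so an entrywise
    comparison suffices. *)
Lemma normFq_weight_mxM m n (w : 'rV[R]_m) (A : 'M[quat R]_(m, n)) :
  normFq (weight_mx w *m A) <= normFq (weight_mx w) * normFq A.
Proof.
apply: ler_normFq => [|i j]; first exact: normFq_ge0.
have -> : (weight_mx w *m A) i j = realq (w 0 i) * A i j.
  rewrite mxE (bigD1 i)//= big1 => [|k ki].
    by rewrite !mxE eqxx mulr1n addr0.
  rewrite !mxE eq_sym (negPf ki) mulr0n.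
  by have -> : realq (0 : R) = 0 by []; rewrite mul0r.
rewrite normq_realqM ler_wpM2r ?sqr_ge0//.
have -> : w 0 i ^+ 2 = normq (weight_mx w i i) ^+ 2.
  by rewrite normq_sqr !mxE eqxx mulr1n /= !expr0n /= !addr0.
by rewrite ler_pXn2r ?nnegrE ?sqrtr_ge0 ?normq_le_normFq.
Qed.

Lemma normFq_weighted_diff_le m n p q (w w' : 'rV[R]_m)
    (P : 'M[quat R]_(m, p)) (Q : 'M[quat R]_(n, p))
    (P' : 'M[quat R]_(m, q)) (Q' : 'M[quat R]_(n, q)) :
  ctransq P *m P = 1%:M -> ctransq Q *m Q = 1%:M ->
  ctransq P' *m P' = 1%:M -> ctransq Q' *m Q' = 1%:M ->
  normFq (weight_mx w *m P *m ctransq Q - weight_mx w' *m P' *m ctransq Q') <=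
  normFq (weight_mx w) * Num.sqrt p%:R + normFq (weight_mx w') * Num.sqrt q%:R.
Proof.
move=> PP QQ PP' QQ'; rewrite -!mulmxA.
apply: (le_trans (normFqB_le _ _)).
rewrite -(normFq_orthonormal_mul PP QQ) -(normFq_orthonormal_mul PP' QQ').
by rewrite lerD// normFq_weight_mxM.
Qed.

End FrobeniusNorm.

(** * Convergence from geometrically bounded steps *)

Section Convergence.
Variable R : realType.

(** The sequence is its initial value plus a telescoping series, which converges absolutely by
    comparison with a geometric one. *)
Lemma cvgn_geometric_steps (f : nat -> R) (a z : R) : 0 <= z -> z < 1 ->
  (forall k, `|f k.+1 - f k| <= a * z ^+ k) -> cvgn f.
Proof.
move=> z0 z1 fz.
have -> : f = cst (f 0%N) + series (telescope f).
  by apply/funext => k; exact: eq_sum_telescope.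
apply: is_cvgD; first exact: is_cvg_cst.
apply: normed_cvg; apply: (@series_le_cvg _ _ (geometric a z)) => //= [k|].
  exact: le_trans (fz k).
by apply: is_cvg_geometric_series; rewrite ger0_norm.
Qed.

Lemma normFq_cvg_geometric_steps m n (X : nat -> 'M[quat R]_(m, n)) (a z : R) :
  0 <= z -> z < 1 -> (forall k, normFq (X k.+1 - X k) <= a * z ^+ k) ->
  exists L : 'M[quat R]_(m, n), (fun k => normFq (X k - L)) @ \oo --> (0 : R).
Proof.
move=> z0 z1 Xz.
(* Here [g] stands for any of the four real coordinates; being 1-Lipschitz for [normq], each
   inherits the geometric bound on the steps. *)
have cvg_coord (g : quat R -> R) i j :
    (forall x y, `|g x - g y| <= normq (x - y)) -> cvgn (fun k => g (X k i j)).
  move=> gN; apply: (cvgn_geometric_steps z0 z1) => k.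
  apply: le_trans (Xz k); apply: le_trans (gN _ _) _.
  by have := normq_le_normFq (X k.+1 - X k) i j; rewrite !mxE.
have norm_le (x : quat R) : [/\ `|qre x| <= normq x, `|qi x| <= normq x,
    `|qj x| <= normq x & `|qk x| <= normq x].
  by split; rewrite -sqrtr_sqr ler_wsqrtr//; nra.
pose L := \matrix_(i, j) Quat (limn (fun k => qre (X k i j)))
  (limn (fun k => qi (X k i j))) (limn (fun k => qj (X k i j)))
  (limn (fun k => qk (X k i j))).
(* Writing the target as the square root of 0 reduces the claim, by continuity, to the finite sum of
   squared coordinates, treated term by term. *)
exists L; rewrite -[X in _ --> X](sqrtr0 R).
apply: (@continuous_cvg _ _ _ _ _ _ Num.sqrt); first exact: sqrt_continuous.
have sqr_cvg (g : quat R -> R) i j : (forall x y, g (x - y) = g x - g y) ->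
    (forall x, `|g x| <= normq x) -> g (L i j) = limn (fun k => g (X k i j)) ->
    (fun k => g ((X k - L) i j) ^+ 2) @ \oo --> (0 : R).
  move=> gB gN gL.
  have gXL : (fun k => g (X k i j) - g (L i j)) @ \oo --> (0 : R).
    rewrite -(subrr (g (L i j))); apply: cvgB; last exact: cvg_cst.
    by rewrite [X in _ --> X]gL; apply: cvg_coord => x y; rewrite -gB.
  under eq_fun do rewrite 2!mxE gB expr2.
  by rewrite -(mulr0 (0 : R)); exact: cvgM.
have s0 : \sum_(i < m) \sum_(j < n) (0 : R) = 0
  by rewrite big1// => i _; rewrite big1.
rewrite -[X in _ --> X]s0.
apply: cvg_big => [|i _]; first exact: add_continuous.
apply: cvg_big => [|j _]; first exact: add_continuous.
under eq_fun do rewrite normq_sqr.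
have -> : (0 : R) = 0 + 0 + 0 + 0 by rewrite !addr0.
by do 3?[apply: cvgD]; apply: sqr_cvg => // [x|]; try (by case: (norm_le x));
   rewrite mxE.
Qed.

End Convergence.

(** Both sides of the conclusion are positive, so it may be checked after taking logarithms;
    [ln rho] is positive, which allows clearing the denominator. *)
Lemma le_mulX_of_ln (R : realType) (c e rho : R) (k : nat) : 0 < c -> 0 < e -> 1 < rho ->
  - ((ln e - ln c) / ln rho) <= k%:R -> c <= e * rho ^+ k.
Proof.
move=> c0 e0 rho1; have rho0 : 0 < rho by exact: lt_trans rho1.
rewrite -mulNr ler_pdivrMr ?ln_gt0// => h.
rewrite -ler_ln ?posrE ?mulr_gt0 ?exprn_gt0// lnM ?posrE ?exprn_gt0// lnXn//.
by rewrite -mulr_natl; lra.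
Qed.


Theorem theorem4 (R : realType) (m n r : nat)
    (hmn : (m <= n)%N) (hrm : (r <= m)%N)
    (M : 'M[quat R]_(m, n)) (Omega : {set 'I_m * 'I_n})
    (wt wh : 'rV[R]_m)
    (hwt : admissible_weights Omega wt)
    (hwh : admissible_weights Omega wh)
    (W1 W2 : 'M[quat R]_m)
    (hW1 : W1 = weight_mx wt) (hW2 : W2 = weight_mx wh)
    (rho : R) (eps : nat -> R)
    (heps1 : 0 < eps 1%N) (hrho : 1 < rho)
    (heps : forall k : nat, (1 <= k)%N -> eps k.+1 = rho * eps k)
    (X Xt : nat -> 'M[quat R]_(m, n))
    (U : nat -> 'M[quat R]_m) (Sigma : nat -> 'M[R]_(m, n))
    (V : nat -> 'M[quat R]_n)
    (A : nat -> 'M[quat R]_m) (B : nat -> 'M[quat R]_(m, n))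
    (C : nat -> 'M[quat R]_(r, m)) (D : nat -> 'M[quat R]_(r, n))
    (hsvd : forall k : nat, (1 <= k)%N -> is_qsvd (X k) (U k) (Sigma k) (V k))
    (hA : forall k : nat, (1 <= k)%N -> A k = ctransq (U k))
    (hB : forall k : nat, (1 <= k)%N ->
       B k = ctransq (first_cols hmn (V k)))
    (hC : forall k : nat, (1 <= k)%N ->
       C k = ctransq (first_cols hrm (U k)))
    (hD : forall k : nat, (1 <= k)%N ->
       D k = ctransq (first_cols (leq_trans hrm hmn) (V k)))
    (hX1 : X 1%N = proj_on Omega M)
    (hXt : forall k : nat, (1 <= k)%N ->
       Xt k.+1 = X k - realq (1 / eps k) *:
         (W1 *m ctransq (A k) *m B k - W2 *m ctransq (C k) *m D k))
    (hX : forall k : nat, (1 <= k)%N ->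
       X k.+1 = proj_on (~: Omega)%SET (Xt k.+1) + proj_on Omega M) :
  (exists L : 'M[quat R]_(m, n),
     (fun k : nat => normFq (X k - L)) @ \oo --> (0 : R)) /\
  (forall tol : R, 0 < tol ->
   forall N : nat, (1 <= N)%N ->
     1 - (ln (eps 1%N * tol)
          - ln (normFq W1 * Num.sqrt m%:R + normFq W2 * Num.sqrt r%:R))
         / ln rho <= N%:R ->
     normFq (X N.+1 - X N) <= tol).
Proof.
set c := normFq W1 * Num.sqrt m%:R + normFq W2 * Num.sqrt r%:R.
have c0 : 0 <= c by rewrite addr_ge0// mulr_ge0 ?normFq_ge0 ?sqrtr_ge0.
have rho0 : 0 < rho by exact: lt_trans hrho.
have epsE k : eps k.+1 = eps 1%N * rho ^+ k.
  by elim: k => [|k IH]; rewrite ?expr0 ?mulr1// heps// IH exprS mulrCA.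
have eps0 k : 0 < eps k.+1 by rewrite epsE mulr_gt0 ?exprn_gt0.
have XOmega k i j : (i, j) \in Omega -> X k.+1 i j = M i j.
  move=> ij; case: k => [|k]; first by rewrite hX1 mxE ij.
  by rewrite hX// !mxE inE ij add0r.
have step k : normFq (X k.+2 - X k.+1) <= c / eps k.+1.
  have [uU uV _ _] := hsvd k.+1 isT.
  have [[UU _] [VV _]] := (uU, uV).
  pose G := W1 *m ctransq (A k.+1) *m B k.+1 - W2 *m ctransq (C k.+1) *m D k.+1.
  have Gc : normFq G <= c.
    rewrite /G /c hA// hB// hC// hD// !ctransqK hW1 hW2.
    by apply: normFq_weighted_diff_le => //; exact: first_cols_orthonormal.
  (* Entrywise comparison with [G]: on [Omega] both iterates equal [M] and the step vanishes;
     elsewhere it is exactly minus [G] scaled by the inverse of [eps k.+1]. *)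
  apply: (@le_trans _ _ ((eps k.+1)^-1 * normFq G)); last first.
    by rewrite mulrC ler_wpM2r// invr_ge0 ltW.
  apply: ler_normFq => [|i j]; first by rewrite invr_ge0 ltW.
  have [ij|ij] := boolP ((i, j) \in Omega).
    rewrite !mxE !XOmega// subrr normq0 expr0n /=.
    by rewrite mulr_ge0 ?sqr_ge0.
  rewrite -normq_realqM !mxE hX// !mxE inE (negPf ij) /= addr0 hXt// -/G.
  rewrite !mxE addrAC subrr add0r div1r.
  rewrite !normq_sqr /= !sqrrN; exact: lexx.
split.
  have z1 : rho^-1 < 1 by rewrite invf_lt1.
  (* The recursion starts at index 1, so the shifted sequence is used; a shift does not affect the
     limit. *)
  have [|k|L XL] := @normFq_cvg_geometric_steps _ _ _ (fun k => X k.+1)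
    (c / eps 1%N) rho^-1 _ z1.
  - by rewrite invr_ge0 ltW.
  - by apply: le_trans (step k) _; rewrite epsE invfM mulrA exprVn.
  by exists L; rewrite -cvg_shiftS.
move=> tol tol0 [//|N] _ hN.
apply: le_trans (step N) _; rewrite ler_pdivrMr// epsE.
(* If [c] vanishes, as it does for [m = 0], [ln c] carries no information, but the bound is then
   immediate from the sign of the right-hand side. *)
have [c_gt0|] := ltP 0 c; last first.
  by move=> /le_trans; apply; rewrite !mulr_ge0 ?exprn_ge0 ?ltW.
rewrite mulrA (mulrC tol); apply: le_mulX_of_ln; rewrite ?mulr_gt0//.
(* The index is now the predecessor of the original one, which absorbs the leading 1 of the
   threshold. *)
by move: hN; rewrite -natr1; lra.
Qed.
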